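(* There is in general no closed-form formula (in radicals) for the positive root of the trinomial $p(x) = x^r - x^{r-l} - 1$. That is, it is not the case that for all integers $1 \le l \le r$ the unique positive real root of $x^r - x^{r-l} - 1$ (which is also its unique root greater than $1$) can be expressed by radicals over $\mathbb{Q}$.
   Context: A number is expressible by radicals over $\mathbb{Q}$ if it can be obtained from rational numbers by finitely many field operations and extractions of $n$-th roots ($n \ge 1$). The trinomial arises as the characteristic polynomial of the recurrence $t(G) = 1$ for $G \le 0$, $t(G) = 1 + t(G-l) + t(G-r)$ for $G > 0$; its root greater than $1$ is called the ratio $\varphi$ of the variable $(l,r)$. *)

(* Defs.v *)
From HB Require Import structures.
From mathcomp Require Import all_boot all_order all_algebra.
From mathcomp Require Import reals complex.

Set Implicit Arguments.
Unset Strict Implicit.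
Unset Printing Implicit Defensive.

Import Order.TTheory GRing.Theory Num.Theory.
Local Open Scope ring_scope.

Definition trinomial (R : nzRingType) (l r : nat) : {poly R} :=
  'X^r - 'X^(r - l) - 1.

(* The smallest subset of C that contains the rationals and is closed under
   the field operations and under n-th roots.  Every y with y ^+ n = x counts
   as an n-th root of x, so no branch of the root is singled out, and all the
   intermediate values may be complex.  The case x = 0 of [rad_inv] adds
   nothing, since 0^-1 = 0. *)
Inductive by_radicals (C : numClosedFieldType) : C -> Prop :=
  | rad_rat (q : rat) : by_radicals (ratr q)
  | rad_add (x y : C) : by_radicals x -> by_radicals y -> by_radicals (x + y)
  | rad_opp (x : C) : by_radicals x -> by_radicals (- x)
  | rad_mul (x y : C) : by_radicals x -> by_radicals y -> by_radicals (x * y)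
  | rad_inv (x : C) : by_radicals x -> by_radicals x^-1
  | rad_root (n : nat) (y : C) :
      (0 < n)%N -> by_radicals (y ^+ n) -> by_radicals y.

Definition positive_root (R : realType) (p : {poly R}) (x : R) : Prop :=
  0 < x /\ root p x.

Definition root_gt1 (R : realType) (p : {poly R}) (x : R) : Prop :=
  1 < x /\ root p x.

(* Main.v *)
Require Import Defs.
From HB Require Import structures.
From mathcomp Require Import boolp classical_sets.
From mathcomp Require Import all_boot all_order all_algebra.
From mathcomp Require Import all_fingroup all_solvable all_field.
From mathcomp Require Import ring_quotient ring.
From mathcomp Require Import reals complex.

(** The positive root. The equation x^r - x^(r-l) - 1 = 0 is equivalent to
    x^(r-l) (x^l - 1) = 1. The left-hand side is nonpositive for 0 < x <= 1 and
    increasing for x >= 1, and it is at least 1 at x = 2. So there is exactly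
    one positive root, and it is greater than 1 ([trinomial_positive_root]).

    No formula in radicals. The trinomial x^5 - x - 1 (l = 4, r = 5) has the
    symmetric group S_5 as its Galois group, and none of its roots is expressible
    by radicals. The proof works with the group Omega of all automorphisms of the
    field of algebraic numbers in place of Galois groups of finite extensions, so
    that no tower of radical extensions has to be normalized.

    - Every number expressible by radicals is fixed by some term of the derived
      series of Omega ([radicals_fixed]). Indeed commutators fix the roots of
      unity; and if a term of positive index fixes y^n, then its elements
      multiply y by roots of unity, which they fix, so they commute at y and
      their commutators fix y.
    - Omega acts on the five roots of x^5 - x - 1 through all of S_5
      ([bring_galois_group]). This follows from Dedekind's theorem
      ([frobenius_element]) at two primes: modulo 5 the Frobenius map is the
      5-cycle x -> x + 1, modulo 2 it has cycle lengths 2 and 3, and its cube is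
      a transposition.
    - The terms of the derived series of Omega act through those of S_5
      ([derived_lift]), which are normal and nontrivial, and hence move each of
      the five roots ([bring_not_by_radicals]).

    Two tools are needed. The extension of embeddings from subfields to the whole
    field of algebraic numbers ([extend_partial_embedding]) gives an embedding
    into any algebraically closed field with conjugation, which transfers the
    question from there to the algebraic numbers, and it shows that a number
    fixed by Omega is rational. A maximal ideal of the ring of algebraic integers
    that contains p ([alg_int_residue]) gives the reduction modulo p in
    Dedekind's theorem. *)

Import Order.TTheory GRing.Theory Num.Theory.
Local Open Scope ring_scope.

Set Implicit Arguments.
Unset Strict Implicit.
Unset Printing Implicit Defensive.

(** * Embeddings of the algebraic numbers *)

(** Zorn's lemma for inclusion, above a given set. The chain condition concerns
    nonempty chains only, since the union of the empty chain is the empty set,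
    which is neither an ideal nor the graph of a homomorphism. *)
Lemma zorn_above (T : Type) (P : set T -> Prop) (A0 : set T) :
    P A0 ->
    (forall F : set (set T), (exists X, F X) -> (forall X, F X -> P X) ->
       total_on F classical_sets.subset -> P (\bigcup_(X in F) X)%classic) ->
  exists A, [/\ P A, (A0 `<=` A)%classic
              & forall B, P B -> (A `<=` B)%classic -> (B `<=` A)%classic].
Proof.
move=> PA0 Pchain.
pose Q :=
  [set A | A = classical_sets.set0 \/ P A /\ (A0 `<=` A)%classic]%classic.
have [F FQ totF|A [QA maxA]] := @Zorn_bigcup T Q.
  have [[X [FX X0]]|noX] :=
      pselect (exists X, F X /\ X <> classical_sets.set0); last first.
    left; rewrite -classical_sets.subset0 => x [Y FY Yx].
    by apply: noX; exists Y; split=> // Y0; rewrite Y0 in Yx.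
  pose F1 := [set Y | F Y /\ Y <> classical_sets.set0]%classic.
  have -> : (\bigcup_(Y in F) Y = \bigcup_(Y in F1) Y)%classic.
    apply/seteqP; split=> x [Y FY Yx]; last by exists Y; case: FY.
    by exists Y => //; split=> // Y0; rewrite Y0 in Yx.
  have FP Y : F1 Y -> P Y /\ (A0 `<=` Y)%classic.
    by case=> FY Y0; case: (FQ _ FY).
  right; split.
    apply: Pchain => [|Y /FP[]//|Y Z [FY _] [FZ _]]; last exact: totF.
    by exists X.
  by move=> x A0x; exists X => //; apply: (FP X _).2.
have [PA A0A] : P A /\ (A0 `<=` A)%classic.
  case: QA => // A_eq0; have [A00|A0n] := pselect (A0 = classical_sets.set0).
    by rewrite A_eq0 -A00; split.
  case: (maxA A0); last by right; split.
  by rewrite A_eq0; split=> //; rewrite classical_sets.subset0.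
exists A; split=> // B PB AB; apply: contrapT => nBA.
by apply: (maxA B) => //; right; split=> //; apply: classical_sets.subset_trans AB.
Qed.

Definition diag_rat (C : numClosedFieldType) (q : rat) : algC * C :=
  (ratr q, ratr q).

Fact diag_rat_is_zmod_morphism C : zmod_morphism (diag_rat C).
Proof. by move=> x y; rewrite /diag_rat !rmorphB. Qed.

Fact diag_rat_is_monoid_morphism C : monoid_morphism (diag_rat C).
Proof. by split=> [|x y]; rewrite /diag_rat ?rmorph1 ?rmorphM. Qed.

HB.instance Definition _ (C : numClosedFieldType) :=
  GRing.isZmodMorphism.Build rat (algC * C)%type (diag_rat C)
    (diag_rat_is_zmod_morphism C).
HB.instance Definition _ (C : numClosedFieldType) :=
  GRing.isMonoidMorphism.Build rat (algC * C)%type (diag_rat C)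
    (diag_rat_is_monoid_morphism C).

(** A ring homomorphism from a subring of [algC] to [C], given by its graph.
    Graphs are subsets of one fixed ring, so that unions of chains of partial
    homomorphisms and adjunction of an element are both plain set operations.
    The domain of such a graph is a subfield, because a subring of [algC] that
    contains the rationals is closed under inverses ([partial_embedding_inv]). *)
Record partial_embedding (C : numClosedFieldType) (S : {pred algC * C}) : Prop :=
  PartialEmbedding {
    graph_rat : forall q, diag_rat C q \in S;
    graph_subring : subring_closed S;
    graph_fun : forall a, (0, a) \in S -> a = 0 }.

Lemma ratr_polyP (z : algC) :
  exists2 p : {poly rat}, p \is monic & root (map_poly ratr p) z.
Proof.
by have [p [Dp mp] _] := minCpolyP z; exists p => //; rewrite -Dp root_minCpoly.
Qed.

Lemma partial_embedding_subring (C : numClosedFieldType) (S : {pred algC * C}) :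
  partial_embedding S -> exists SS : subringClosed (algC * C)%type, S = SS.
Proof.
case=> _ S_sub _; pose SM := GRing.isSubringClosed.Build _ _ S_sub.
by exists (HB.pack S SM : subringClosed _).
Qed.

(** An algebraic number has its inverse among its own rational polynomials, and
    the same polynomial evaluated in the graph supplies the partner. *)
Lemma partial_embedding_inv (C : numClosedFieldType) (S : {pred algC * C}) x a :
  partial_embedding S -> (x, a) \in S -> x != 0 -> exists b, (x^-1, b) \in S.
Proof.
move=> peS; have [SS DS] := partial_embedding_subring peS; subst S.
case: peS => Srat _ _ Sxa x0.
have [p mp] := ratr_polyP x^-1; rewrite /root horner_coef size_map_poly.
have := monic_neq0 mp; rewrite -size_poly_gt0.
case Dn: (size p) => [//|n] _; rewrite big_ord_recr /= => /eqP.
have -> : (map_poly ratr p : {poly algC})`_n = 1.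
  by rewrite coef_map -[n]/(n.+1.-1) -Dn -lead_coefE (monicP mp) /= rmorph1.
case: n => [|n] in Dn *.
  by rewrite big_ord0 add0r expr0 mulr1 => /eqP; rewrite oner_eq0.
rewrite mul1r => /eqP; rewrite addrC addr_eq0 => /eqP Dx.
pose u := - \sum_(i < n.+1) diag_rat C p`_i * (x, a) ^+ (n - i).
have Su : u \in SS.
  by rewrite rpredN rpred_sum // => i _; rewrite rpredM ?rpredX //; apply: Srat.
exists u.2; suff -> : x^-1 = u.1 by rewrite -surjective_pairing.
have -> : x^-1 = x ^+ n * x^-1 ^+ n.+1.
  by rewrite exprS mulrCA -exprMn divff // expr1n mulr1.
rewrite Dx mulrN mulr_sumr [RHS](raddfN fst) (raddf_sum fst); congr (- _).
apply: eq_bigr => -[i ltin] _ /=; rewrite coef_map rmorphXn /= mulrCA; congr (_ * _).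
by rewrite -{1}(subnK (ltnSE ltin)) exprD exprVn mulfK // expf_neq0.
Qed.

(** The classical extension step: the minimal polynomial of [z] over the domain
    of the graph is carried to [C], where it has a root [w], and [z] is sent to
    [w]. Polynomials over the graph are polynomials over the product ring
    [algC * C], so the old and the new domain are handled in one evaluation. *)
Lemma partial_embedding_adjoin (C : numClosedFieldType) (S : {pred algC * C}) z :
  partial_embedding S ->
  exists (T : {pred algC * C}) w,
    [/\ partial_embedding T, {subset S <= T} & (z, w) \in T].
Proof.
move=> peS; have [SS DS] := partial_embedding_subring peS; subst S.
have [Srat _ Sfun] := peS.
have Sfun1 u : u \in SS -> u.1 = 0 -> u = 0.
  by case: u => x a /= + x0; rewrite x0 => /Sfun->.
pose kills n := exists p : {poly algC * C},
  [/\ p \is a polyOver SS, p \is monic, size p = n & root (map_poly fst p) z].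
have ex_kills : exists n, `[< kills n >].
  have [p mp pz0] := ratr_polyP z.
  exists (size (map_poly (diag_rat C) p)); apply/asboolP.
  exists (map_poly (diag_rat C) p); split=> //.
  - by apply/polyOverP=> i; rewrite coef_map; apply: Srat.
  - exact: monic_map.
  - by rewrite -map_poly_comp.
case: (ex_minnP ex_kills) => n /asboolP[p [Sp mp szp pz0]] min_n.
(* A nonzero annihilating polynomial can be made monic, since its leading
   coefficient is invertible in the graph; hence its size is at least n. *)
have small q : q \is a polyOver SS -> root (map_poly fst q) z ->
    (size q < n)%N -> q = 0.
  move=> Sq qz0 ltqn; apply: contraTeq ltqn => q0; rewrite -leqNgt.
  have Slq : lead_coef q \in SS by apply: (polyOverP Sq).
  have lq1 : (lead_coef q).1 != 0.
    by apply: contra_neq q0 => /(Sfun1 _ Slq)/eqP; rewrite lead_coef_eq0 => /eqP.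
  have [b Sb] : exists b, ((lead_coef q).1^-1, b) \in SS.
    by apply: (partial_embedding_inv (a := (lead_coef q).2) peS); rewrite -?surjective_pairing.
  pose c := ((lead_coef q).1^-1, b).
  have c1 : c * lead_coef q = 1.
    apply/eqP; rewrite -subr_eq0; apply/eqP; apply: Sfun1.
      by have: c * lead_coef q - 1 \in SS by rewrite rpredB ?rpred1 // rpredM.
    by rewrite /= mulVf // subrr.
  have creg : GRing.lreg c.
    move=> u v /(congr1 ( *%R (lead_coef q))).
    by rewrite !mulrA ![_ * c]mulrC c1 !mul1r.
  apply: min_n; apply/asboolP; exists (c *: q); split.
  - by apply: polyOverZ.
  - by rewrite monicE lead_coef_lreg //; apply/eqP.
  - by rewrite lreg_size.
  - by rewrite map_polyZ /= rootZ ?invr_eq0.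
have [w pw0] : exists w, root (map_poly snd p) w.
  apply/closed_rootP; rewrite neq_ltn; apply/orP; right.
  have snd1 : snd (lead_coef p) != 0 by rewrite (monicP mp) oner_neq0.
  have fst1 : fst (lead_coef p) != 0 by rewrite (monicP mp) oner_neq0.
  rewrite size_map_poly_id0 // -(size_map_poly_id0 fst1).
  apply: root_size_gt1 pz0.
  by rewrite -size_poly_eq0 size_map_poly_id0 // size_poly_eq0 monic_neq0.
have hornerE2 q : q.[(z, w)] = ((map_poly fst q).[z], (map_poly snd q).[w]).
  by rewrite [LHS]surjective_pairing -!(horner_map, horner_map) /=.
(* Euclidean division by p, as an induction on the size of q. *)
have root_w q : q \is a polyOver SS -> root (map_poly fst q) z ->
    root (map_poly snd q) w.
  have [m] := ubnP (size q); elim: m => // m IHm in q *.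
  rewrite ltnS => leqm Sq qz0; have [ltqn|lenq] := ltnP (size q) n.
    by rewrite (small q) // rmorph0 root0.
  have [->|q0] := eqVneq q 0; first by rewrite rmorph0 root0.
  pose c := (lead_coef q)%:P; pose t := c * 'X^(size q - n).
  have c0 : c != 0 by rewrite polyC_eq0 lead_coef_eq0.
  have szt : size (t * p) = size q.
    have szcX : size (c * 'X^(size q - n)) = (size q - n).+1.
      by rewrite size_Mmonic ?monicXn // size_polyXn size_polyC lead_coef_eq0 q0.
    by rewrite size_Mmonic // -?size_poly_eq0 szcX // szp addSn /= subnK.
  have lt : lead_coef (t * p) = lead_coef q.
    by rewrite !lead_coef_Mmonic ?monicXn // lead_coefC.
  have St : t \is a polyOver SS.
    by rewrite rpredM ?polyOverXn // polyOverC; apply: (polyOverP Sq).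
  have : root (map_poly snd (q - t * p)) w.
    apply: IHm.
    - apply: leq_trans leqm; rewrite -(prednK (n := size q)) ?size_poly_gt0 //.
      rewrite ltnS; apply/leq_sizeP => j; rewrite leq_eqVlt coefB => /predU1P[<-|].
        by rewrite -{2}szt -!lead_coefE lt subrr.
      by rewrite prednK ?size_poly_gt0 // => lej; rewrite !nth_default ?szt ?subrr.
    - by rewrite rpredB // rpredM.
    - by rewrite rmorphB rmorphM /= /root hornerD hornerN hornerM (eqP pz0) mulr0 subr0.
  by rewrite rmorphB rmorphM /= /root hornerD hornerN hornerM (eqP pw0) mulr0 subr0.
pose T : {pred algC * C} := fun u =>
  `[< exists2 q, q \is a polyOver SS & u = q.[(z, w)] >].
exists T, w; split.
- split=> [q||a].
  + by apply/asboolP; exists (diag_rat C q)%:P; rewrite ?polyOverC ?hornerC //; apply: Srat.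
  + split; first by apply/asboolP; exists 1; rewrite ?rpred1 ?hornerC.
      move=> u v /asboolP[q Sq ->] /asboolP[r Sr ->]; apply/asboolP.
      by exists (q - r); rewrite ?rpredB // hornerD hornerN.
    move=> u v /asboolP[q Sq ->] /asboolP[r Sr ->]; apply/asboolP.
    by exists (q * r); rewrite ?rpredM // hornerM.
  + case/asboolP=> q Sq; rewrite hornerE2 => -[/esym/eqP/root_w qw0 ->].
    exact/eqP/qw0.
- move=> u Su; apply/asboolP; exists u%:P; rewrite ?hornerC //.
  by rewrite polyOverC.
by apply/asboolP; exists 'X; rewrite ?polyOverX ?hornerX.
Qed.

(** A maximal graph is total, by [partial_embedding_adjoin]. *)
Lemma extend_partial_embedding (C : numClosedFieldType) (S : {pred algC * C}) :
  partial_embedding S ->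
  exists iota : {rmorphism algC -> C}, forall u, u \in S -> iota u.1 = u.2.
Proof.
move=> peS; pose P (X : set (algC * C)) := partial_embedding (fun u => `[< X u >]).
have [||M [peM SM maxM]] := @zorn_above _ P (fun u => u \in S).
- case: peS => Srat [S1 SB SMul] Sfun; split=> [q||a]; first exact/asboolP.
    split=> [|u v /asboolP Su /asboolP Sv|u v /asboolP Su /asboolP Sv]; apply/asboolP => //.
      exact: SB.
    exact: SMul.
  by move/asboolP/Sfun.
- move=> F [X0 FX0] FP totF.
  have common u v :
      (\bigcup_(X in F) X)%classic u -> (\bigcup_(X in F) X)%classic v ->
      exists2 X, F X & X u /\ X v.
    move=> [X FX Xu] [Y FY Yv]; have [XY|YX] := totF _ _ FX FY.
      by exists Y => //; split=> //; apply: XY.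
    by exists X => //; split=> //; apply: YX.
  split=> [q||a].
  + by apply/asboolP; exists X0 => //; apply/asboolP; apply: (graph_rat (FP _ FX0)).
  + split=> [|u v /asboolP Fu /asboolP Fv|u v /asboolP Fu /asboolP Fv]; apply/asboolP.
    * exists X0 => //; apply/asboolP.
      by have [+ _ _] := graph_subring (FP _ FX0).
    * have [X FX [Xu Xv]] := common _ _ Fu Fv; exists X => //; apply/asboolP.
      by have [_ XB _] := graph_subring (FP _ FX); apply: XB; apply/asboolP.
    * have [X FX [Xu Xv]] := common _ _ Fu Fv; exists X => //; apply/asboolP.
      by have [_ _ XM] := graph_subring (FP _ FX); apply: XM; apply/asboolP.
  + move=> /asboolP[X FX Xa]; apply: (graph_fun (FP _ FX)).
    exact/asboolP.
have totM z : exists w, M (z, w).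
  have [T [w [peT MT Tzw]]] := partial_embedding_adjoin z peM; exists w.
  apply: (maxM (fun u => u \in T)) Tzw => [|u Mu]; last exact/MT/asboolP.
  by congr partial_embedding: peT; apply/funext => u; rewrite asboolb.
have /choice[f Mf] := totM.
have [SS DS] := partial_embedding_subring peM.
have SSP u : reflect (M u) (u \in SS) by rewrite -DS; apply: asboolP.
have f_uniq z w : M (z, w) -> f z = w.
  move=> Mzw; apply/eqP; rewrite -subr_eq0; apply/eqP; apply: (graph_fun peM).
  have : (z, f z) - (z, w) \in SS by rewrite rpredB //; apply/SSP.
  by rewrite DS [_ - _](_ : _ = (0, f z - w)) // -(subrr z).
have f_zmod : zmod_morphism f.
  move=> x y; apply: f_uniq; apply/SSP.
  by apply: (@rpredB _ SS (x, f x) (y, f y)); apply/SSP.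
have f_monoid : monoid_morphism f.
  split=> [|x y]; apply: f_uniq; apply/SSP; first exact: (rpred1 SS).
  by apply: (@rpredM _ SS (x, f x) (y, f y)); apply/SSP.
pose fA := GRing.isZmodMorphism.Build _ _ f f_zmod.
pose fM := GRing.isMonoidMorphism.Build _ _ f f_monoid.
exists (HB.pack f fA fM : {rmorphism algC -> C}) => -[x a] Sxa /=.
exact/f_uniq/SM.
Qed.

Lemma embed_algC (C : numClosedFieldType) : inhabited {rmorphism algC -> C}.
Proof.
pose S : {pred algC * C} := fun u => `[< exists q, u = diag_rat C q >].
have [|iota _] := @extend_partial_embedding C S; last by [].
split=> [q||a]; first by apply/asboolP; exists q.
  split; first by apply/asboolP; exists 1; rewrite rmorph1.
    move=> u v /asboolP[q ->] /asboolP[r ->]; apply/asboolP.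
    by exists (q - r); rewrite rmorphB.
  move=> u v /asboolP[q ->] /asboolP[r ->]; apply/asboolP.
  by exists (q * r); rewrite rmorphM.
by case/asboolP=> q [/esym/eqP]; rewrite fmorph_eq0 => /eqP-> ->; rewrite rmorph0.
Qed.

(** Sending [q(x)] to [q(y)] is well defined when [x] and [y] have the same
    minimal polynomial; any extension of this map to [algC] is an automorphism. *)
Lemma conjugate_aut (x y : algC) :
  root (minCpoly x) y -> exists nu : {rmorphism algC -> algC}, nu x = y.
Proof.
move=> xy; pose S : {pred algC * algC} := fun u =>
  `[< exists p : {poly rat}, u = (map_poly (diag_rat _) p).[(x, y)] >].
have hornerE2 (p : {poly rat}) : (map_poly (diag_rat algC) p).[(x, y)] =
    ((map_poly ratr p).[x], (map_poly ratr p).[y]).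
  rewrite [LHS]surjective_pairing; congr (_, _).
    by rewrite -(horner_map fst) -map_poly_comp.
  by rewrite -(horner_map snd) -map_poly_comp.
have peS : partial_embedding S.
  split=> [q||a]; first by apply/asboolP; exists q%:P; rewrite map_polyC hornerC.
    split; first by apply/asboolP; exists 1; rewrite rmorph1 hornerC.
      move=> u v /asboolP[p ->] /asboolP[q ->]; apply/asboolP.
      by exists (p - q); rewrite rmorphB /= hornerD hornerN.
    move=> u v /asboolP[p ->] /asboolP[q ->]; apply/asboolP.
    by exists (p * q); rewrite rmorphM /= hornerM.
  case/asboolP=> p; rewrite hornerE2 => -[/esym/eqP px0 ->].
  have [m [Dm _] dvd_m] := minCpolyP x.
  have /dvdpP[q ->]: (m %| p)%R by rewrite -dvd_m.
  by rewrite rmorphM hornerM /= -Dm (eqP xy) mulr0.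
have [nu nuS] := extend_partial_embedding peS; exists nu.
apply: (nuS (x, y)); apply/asboolP; exists 'X.
by rewrite map_polyX hornerX.
Qed.

(** All conjugates of [x] equal [x], so the minimal polynomial of [x] is a power
    of ['X - x%:P]; its subdominant coefficient is a nonzero integer multiple of
    [x], and it is rational. *)
Lemma fixed_by_all_auts (x : algC) :
  (forall nu : {rmorphism algC -> algC}, nu x = x) -> x \in Crat.
Proof.
move=> fix_x; have [r Dr] := closed_field_poly_normal (minCpoly x).
rewrite (monicP (minCpoly_monic x)) scale1r in Dr.
have r_x : all (pred1 x) r.
  apply/allP=> y ry; have /conjugate_aut[nu <-] : root (minCpoly x) y.
    by rewrite Dr root_prod_XsubC.
  by rewrite fix_x /=.
have [m [Dm _] _] := minCpolyP x; have := size_minCpoly x.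
rewrite Dr size_prod_XsubC ltnS => r0.
have : (minCpoly x)`_(size r).-1 = - (x *+ size r).
  rewrite {1}Dr coefPn_prod_XsubC -?lt0n // (all_pred1P _ _ r_x) size_nseq.
  by rewrite big_nseq iter_addr addr0.
rewrite Dm coef_map -mulr_natr => /eqP; rewrite eq_sym eqr_oppLR => /eqP.
move/(canRL (mulfK _)) => ->; last by rewrite pnatr_eq0 -lt0n.
by rewrite rpredM ?rpredV ?rpred_nat // rpredN Crat_rat.
Qed.

(** * Reduction of algebraic integers modulo a prime *)

Lemma maximal_ideal (A : comNzRingType) (p : A) : (forall a, a * p <> 1) ->
  exists I : idealr A, p \in (I : {pred A}) /\
    forall x, x \notin (I : {pred A}) -> exists a, a * x - 1 \in (I : {pred A}).
Proof.
move=> p_nonunit.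
pose P (X : set A) :=
  [/\ X 0, ~ X 1 & forall a u v, X u -> X v -> X (a * u + v)].
pose adj (X : set A) (x : A) : set A := fun y => exists a, X (y - a * x).
have ideal_adj X x : P X -> ~ adj X x 1 -> P (adj X x).
  case=> X0 _ XD not1; split=> //; first by exists 0; rewrite mul0r subr0.
  move=> a u v [b Xu] [c Xv]; exists (a * b + c).
  by rewrite mulrDl opprD addrACA -mulrA -mulrBr; apply: XD.
have P0 : P [set 0]%classic.
  by split=> [//|/eqP|a u v -> ->]; rewrite ?oner_eq0 // mulr0 addr0.
have [||M [PM M0 maxM]] := @zorn_above _ P (adj [set 0]%classic p).
- apply: ideal_adj => // -[a] /eqP; rewrite subr_eq0 => /eqP/esym; exact: p_nonunit.
- move=> F [X0 FX0] FP totF; split.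
  + by exists X0 => //; case: (FP _ FX0).
  + by case=> X FX X1; case: (FP _ FX).
  + move=> a u v [X FX Xu] [Y FY Yv]; have [XY|YX] := totF _ _ FX FY.
      by exists Y => //; have [_ _] := FP _ FY; apply=> //; apply: XY.
    by exists X => //; have [_ _] := FP _ FX; apply=> //; apply: YX.
have closedM : idealr_closed (fun x => `[< M x >]).
  case: PM => MM0 MM1 MD; split; first exact/asboolP.
    by apply/asboolP.
  by move=> a u v /asboolP Mu /asboolP Mv; apply/asboolP/MD.
pose IM := isIdealr.Build A (fun x => `[< M x >]) closedM.
pose I : idealr A := HB.pack (fun x : A => `[< M x >]) IM.
exists I; split.
  by apply/asboolP/M0; exists 1; rewrite mul1r subrr.
move=> x /asboolPn nMx; have [[a Ma]|no1] := pselect (adj M x 1).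
  exists a; apply/asboolP; have [M00 _ MD] := PM.
  by have := MD (-1) _ _ Ma M00; rewrite mulN1r addr0 opprB.
case: nMx; apply: (maxM _ (ideal_adj _ _ PM no1)).
  by move=> y My; exists 0; rewrite mul0r subr0.
by exists 1; rewrite mul1r subrr; case: PM.
Qed.

Local Open Scope quotient_scope.

(** The quotient by a maximal ideal containing [p]. *)
Lemma residue_field (A : comNzRingType) (p : A) : (forall a, a * p <> 1) ->
  exists (K : fieldType) (phi : {rmorphism A -> K}), phi p = 0.
Proof.
case/maximal_ideal=> I [Ip invI].
pose Q : comNzRingType := {ideal_quot I}.
have piQ0 x : (\pi_{ideal_quot I} x == 0 :> Q) = (x \in (I : {pred A})).
  by rewrite -[0 :> Q](rmorph0 \pi_{ideal_quot I}) -Quotient.idealrBE subr0.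
have ex_inv (x : Q) : exists y : Q, if x == 0 then y = 0 else y * x = 1.
  have [_|] := eqVneq x 0; first by exists 0.
  rewrite -[x]reprK piQ0 => /invI[a]; rewrite -piQ0 rmorphB rmorph1 rmorphM subr_eq0.
  by move/eqP; exists (\pi a).
have /choice[inv invP] := ex_inv.
have mulVx (x : Q) : x != 0 -> inv x * x = 1.
  by move=> x0; move: (invP x); rewrite (negPf x0).
have inv0 : inv 0 = 0 by move: (invP 0); rewrite eqxx.
pose KM := GRing.ComNzRing_isField.Build Q mulVx inv0.
pose K : fieldType := HB.pack (GRing.ComNzRing.sort Q) KM.
exists K, (\pi_{ideal_quot I} : {rmorphism A -> Q}).
by apply/eqP; rewrite piQ0.
Qed.

Definition alg_int : Type := {x : algC | x \in Aint}.
HB.instance Definition _ := SubChoice.on alg_int.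
HB.instance Definition _ := [SubChoice_isSubComNzRing of alg_int by <:].

(** [p] is not a unit among the algebraic integers, because [p^-1] is rational
    and not an integer. *)
Lemma alg_int_residue (p : nat) : prime p ->
  exists (K : fieldType) (phi : {rmorphism alg_int -> K}), p \in [pchar K].
Proof.
move=> p_pr; have [|K [phi phi_p]] := @residue_field alg_int p%:R.
  move=> a /(congr1 val); rewrite rmorphM rmorph_nat rmorph1 => ap1.
  have p0 : p%:R != 0 :> algC by rewrite pnatr_eq0 -lt0n prime_gt0.
  have Da : val a = p%:R^-1 by apply: (mulIf p0); rewrite ap1 mulVf.
  have /intrP[m Dm] : p%:R^-1 \in (Num.int : {pred algC}).
    by apply: Cint_rat_Aint; rewrite ?rpredV ?rpred_nat // -Da (valP a).
  have : (m * p%:Z)%:~R = 1 :> algC by rewrite intrM -Dm mulVf.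
  move/eqP; rewrite -[1]/(1%:~R) eqr_int => /eqP mp1.
  have: (p %| 1)%Z by apply/dvdzP; exists m.
  by rewrite dvdz1 /= => /eqP p1; rewrite p1 in p_pr.
exists K, phi; rewrite inE p_pr /=.
by rewrite -(rmorph_nat phi) phi_p.
Qed.

(** * Frobenius elements of the Galois group *)

Definition perm_of_aut n (alpha : 'I_n -> algC) (nu : algC -> algC) (s : 'S_n) :=
  forall i, nu (alpha i) = alpha (s i).

(** The Galois group of the polynomial with roots [alpha], as a group of
    permutations of the indices. Taking automorphisms of the whole of [algC]
    gives the same permutations as automorphisms of the splitting field, since
    the latter extend. *)
Definition galois_set n (alpha : 'I_n -> algC) : {set 'S_n} :=
  [set s | `[< exists nu : {rmorphism algC -> algC}, perm_of_aut alpha nu s >]].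

Lemma root_prod_XsubC_fin (K : idomainType) (I : finType) (a : I -> K) x :
  root (\prod_i ('X - (a i)%:P)) x -> exists i, x = a i.
Proof.
rewrite rootE horner_prod => /eqP/eqP/prodf_eq0[i _].
by rewrite hornerXsubC subr_eq0 => /eqP; exists i.
Qed.

Lemma map_prod_XsubC (R S : comNzRingType) (phi : {rmorphism R -> S})
    (I : finType) (a : I -> R) :
  map_poly phi (\prod_i ('X - (a i)%:P)) = \prod_i ('X - (phi (a i))%:P).
Proof.
rewrite rmorph_prod; apply: eq_bigr => i _.
by rewrite rmorphB /= map_polyX map_polyC.
Qed.

Lemma aut_perm n (f : {poly int}) (alpha : 'I_n -> algC)
    (nu : {rmorphism algC -> algC}) :
  map_poly intr f = \prod_i ('X - (alpha i)%:P) -> injective alpha ->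
  exists s, perm_of_aut alpha nu s.
Proof.
move=> Df alpha_inj.
have ex_j i : exists j, nu (alpha i) = alpha j.
  apply: root_prod_XsubC_fin; rewrite -Df.
  have -> : map_poly intr f = map_poly nu (map_poly intr f).
    by rewrite -map_poly_comp; apply: eq_map_poly => m /=; rewrite rmorph_int.
  rewrite fmorph_root Df rootE horner_prod (bigD1 i) //=.
  by rewrite hornerXsubC subrr mul0r.
have /choice[s Ds] := ex_j.
have s_inj : injective s.
  by move=> i j sij; apply/alpha_inj/(fmorph_inj nu); rewrite !Ds sij.
by exists (perm s_inj) => i; rewrite permE Ds.
Qed.

Lemma galois_setP n (alpha : 'I_n -> algC) (s : 'S_n) :
  reflect (exists nu : {rmorphism algC -> algC}, perm_of_aut alpha nu s)
    (s \in galois_set alpha).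
Proof. by rewrite inE; apply: asboolP. Qed.

Fact galois_set_group n (alpha : 'I_n -> algC) : group_set (galois_set alpha).
Proof.
apply/group_setP; split.
  by apply/galois_setP; exists idfun => i; rewrite perm1.
move=> s t /galois_setP[nu nus] /galois_setP[mu mut]; apply/galois_setP.
by exists (mu \o nu) => i; rewrite permM /= nus mut.
Qed.
Canonical galois_group n alpha := Group (@galois_set_group n alpha).

Section Dedekind.

Variables (n : nat) (f : {poly int}) (alpha : 'I_n -> algC).
Hypothesis Df : map_poly intr f = \prod_i ('X - (alpha i)%:P).
Hypothesis alpha_inj : injective alpha.

(** The roots are packed as coefficients of one polynomial, so that an equality
    between two such packages is an equality root by root. *)
Definition generic_combination (R : nzRingType) (a : 'I_n -> R) : {poly R} :=
  \sum_i (a i)%:P * 'X^i.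

Lemma coef_generic_combination (R : nzRingType) (a : 'I_n -> R) (j : 'I_n) :
  (generic_combination a)`_j = a j.
Proof.
rewrite coef_sum (bigD1 j) //= coefMXn ltnn subnn coefC eqxx big1 ?addr0 // => k kj.
by rewrite coefCM coefXn eq_sym (inj_eq val_inj) (negPf kj) mulr0.
Qed.

Lemma map_generic_combination (R S : nzRingType) (phi : {rmorphism R -> S})
    (a : 'I_n -> R) :
  map_poly phi (generic_combination a) = generic_combination (phi \o a).
Proof.
rewrite rmorph_sum; apply: eq_bigr => i _ /=.
by rewrite rmorphM /= map_polyC map_polyXn.
Qed.

(** The polynomial whose roots are the Galois conjugates of the polynomial
    [generic_combination] that packs the roots. *)
Definition galois_resolvent (R : comNzRingType) (a : 'I_n -> R) : {poly {poly R}} :=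
  \prod_(s in galois_set alpha) ('X - (generic_combination (a \o s))%:P).

Lemma map_galois_resolvent (R S : comNzRingType) (phi : {rmorphism R -> S})
    (a : 'I_n -> R) :
  map_poly (map_poly phi) (galois_resolvent a) = galois_resolvent (phi \o a).
Proof.
rewrite rmorph_prod; apply: eq_bigr => s _ /=.
by rewrite rmorphB /= map_polyX map_polyC /= map_generic_combination.
Qed.

(** An automorphism translates the Galois group by the permutation that it
    induces, which only reorders the factors. *)
Lemma galois_resolvent_fixed (nu : {rmorphism algC -> algC}) j k :
  nu (galois_resolvent alpha)`_j`_k = (galois_resolvent alpha)`_j`_k.
Proof.
suff E : map_poly (map_poly nu) (galois_resolvent alpha) = galois_resolvent alpha.
  by rewrite -{2}E !coef_map.
rewrite map_galois_resolvent; have [t nut] := aut_perm nu Df alpha_inj.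
have Gt : t \in galois_set alpha by apply/galois_setP; exists nu.
rewrite [RHS](reindex_inj (mulIg t)); apply: eq_big => [s|s _].
  by rewrite groupMr.
congr ('X - _%:P); congr generic_combination; apply/funext => i /=.
by rewrite permM nut.
Qed.

Lemma root_Aint i : alpha i \in Aint.
Proof.
apply: (@root_monic_Aint (map_poly intr f)).
- by rewrite Df rootE horner_prod (bigD1 i) //= hornerXsubC subrr mul0r.
- by rewrite Df monic_prod_XsubC.
- by apply/polyOverP => j; rewrite coef_map /= rpred_int.
Qed.

Definition int_root i : alg_int := exist _ (alpha i) (root_Aint i).

(** The coefficients are algebraic integers fixed by all automorphisms. *)
Lemma galois_resolvent_int j k :
  exists m : int, (galois_resolvent int_root)`_j`_k = m%:~R.
Proof.
have Dval :
    val (galois_resolvent int_root)`_j`_k = (galois_resolvent alpha)`_j`_k.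
  by rewrite -(map_galois_resolvent val int_root) !coef_map.
have /intrP[m Dm] : (galois_resolvent alpha)`_j`_k \in (Num.int : {pred algC}).
  apply: Cint_rat_Aint; last by rewrite -Dval; apply: valP.
  by apply: fixed_by_all_auts => nu; apply: galois_resolvent_fixed.
by exists m; apply: val_inj; rewrite Dval Dm rmorph_int.
Qed.

(** Dedekind's theorem: raising the reduced roots to the power [p] is induced by
    an element of the Galois group. The resolvent has integer coefficients, so
    its reduction is invariant under the Frobenius map of the residue field;
    thus the Frobenius image of the reduced generic combination is still one of
    the roots of the reduced resolvent, and these are indexed by the group. *)
Lemma frobenius_element (p : nat) : prime p ->
  exists (K : fieldType) (a : 'I_n -> K) s,
    [/\ p \in [pchar K], map_poly intr f = \prod_i ('X - (a i)%:P),
        s \in galois_set alpha & forall i, a i ^+ p = a (s i)].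
Proof.
case/alg_int_residue=> K [phi charKp]; exists K, (phi \o int_root).
have fK : map_poly intr f = \prod_i ('X - ((phi \o int_root) i)%:P).
  have fO : map_poly intr f = \prod_i ('X - (int_root i)%:P).
    apply: (map_inj_poly (f := val : alg_int -> algC)) => //; first exact: val_inj.
    rewrite -map_poly_comp (eq_map_poly (rmorph_int val)) Df.
    exact/esym/(map_prod_XsubC val).
  rewrite -(eq_map_poly (rmorph_int phi)) (map_poly_comp phi) fO.
  exact: map_prod_XsubC.
pose Fr := pFrobenius_aut charKp.
have FrF :
    galois_resolvent (Fr \o (phi \o int_root)) = galois_resolvent (phi \o int_root).
  rewrite -map_galois_resolvent -(map_galois_resolvent phi).
  apply/polyP=> j; apply/polyP=> k; rewrite !(coef_map, coef_map) /=.
  by have [m ->] := galois_resolvent_int j k; rewrite !rmorph_int.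
have : root (galois_resolvent (Fr \o (phi \o int_root)))
    (generic_combination (Fr \o (phi \o int_root))).
  rewrite rootE horner_prod (bigD1 1%g) ?group1 //= hornerXsubC.
  rewrite [X in generic_combination X - _]
    (_ : _ = Fr \o (phi \o int_root) \o (1%g : 'S_n)).
    by rewrite subrr mul0r.
  by apply/funext=> i /=; rewrite perm1.
rewrite FrF rootE horner_prod => /prodf_eq0[s Gs].
rewrite hornerXsubC subr_eq0 => /eqP eq_s; exists s; split=> // i.
by have := congr1 (fun q : {poly K} => q`_i) eq_s; rewrite !coef_generic_combination.
Qed.

End Dedekind.

(** * The Galois group of x^5 - x - 1 *)

Lemma trinomial_bring (R : nzRingType) : trinomial R 4 5 = 'X^5 - 'X - 1.
Proof. by rewrite /trinomial expr1. Qed.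

Lemma map_trinomial (R S : nzRingType) (phi : {rmorphism R -> S}) l r :
  map_poly phi (trinomial R l r) = trinomial S l r.
Proof. by rewrite /trinomial !rmorphB /= !map_polyXn rmorph1. Qed.

Lemma bring_root (R : comNzRingType) (x : R) :
  root (trinomial R 4 5) x -> x ^+ 5 = x + 1.
Proof.
rewrite trinomial_bring rootE hornerD hornerN hornerD hornerN hornerX hornerXn hornerC.
by rewrite -addrA -opprD subr_eq0 => /eqP.
Qed.

(** The discriminant of x^5 - x - 1 is 2869. A double root [r] satisfies both
    [r ^+ 5 = r + 1] and [5 * r ^+ 4 = 1], hence [4 * r = -5]; substituting this
    in the second equation gives [2869 = 0]. *)
Lemma bring_roots_inj (K : idomainType) (a : 'I_5 -> K) : 2869%:R != 0 :> K ->
  trinomial K 4 5 = \prod_i ('X - (a i)%:P) -> injective a.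
Proof.
move=> disc_n0 Df i j aij; apply: contraNeq disc_n0 => neq_ij; set r := a i in aij.
pose q := \prod_(k | (k != i) && (k != j)) ('X - (a k)%:P).
have {}Df : trinomial K 4 5 = ('X - r%:P) * (('X - r%:P) * q).
  by rewrite Df (bigD1 i) //= (bigD1 j) 1?eq_sym //= -aij.
have r5 : r ^+ 5 = r + 1.
  by apply: bring_root; rewrite Df rootE hornerM hornerXsubC subrr mul0r.
have : (trinomial K 4 5)^`().[r] = 0.
  rewrite Df derivM hornerD !hornerM derivXsubC !hornerXsubC subrr.
  by rewrite !(mul0r, mulr0) addr0.
rewrite trinomial_bring !derivB derivXn derivX derivC subr0.
rewrite hornerD hornerN hornerMn hornerXn hornerC => r4.
have r1 : 4 * r + 5 = 0.
  have -> : 4 * r + 5 = r * (r ^+ 5.-1 *+ 5 + -1) - 5 * (r ^+ 5 - (r + 1)) by ring.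
  by rewrite r4 r5; ring.
have -> : 2869%:R = 256 * (r ^+ 5.-1 *+ 5 + -1)
    - 5 * ((16 * r ^+ 2 + 25) * (4 * r - 5) * (4 * r + 5)) :> K by ring.
by rewrite r4 r1 !mulr0 subrr.
Qed.

Lemma order_of_shift (n p : nat) (K : nzRingType) (a : 'I_n.+1 -> K) (s : 'S_n.+1) :
  prime p -> p%:R = 0 :> K -> injective a -> (forall i, a (s i) = a i + 1) ->
  #[s]%g = p.
Proof.
move=> p_pr p0 a_inj as1.
have asX k i : a ((s ^+ k)%g i) = a i + k%:R.
  by elim: k => [|k IHk]; rewrite ?expg0 ?perm1 ?addr0 // expgSr permM as1 IHk mulrSr addrA.
have : (#[s]%g %| p)%N.
  by rewrite order_dvdn; apply/eqP/permP => i; apply: a_inj; rewrite asX p0 addr0 perm1.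
case/primeP: p_pr => _ p_div /p_div/orP[|/eqP//].
rewrite order_eq1 => /eqP s1; have := as1 ord0; rewrite s1 perm1 => /eqP.
by rewrite -subr_eq0 opprD addNKr oppr_eq0 oner_eq0.
Qed.

Lemma tperm_of_moved (T : finType) (s : {perm T}) (B : {set T}) :
  (#|B| <= 2)%N -> B != set0 -> (forall x, (s x != x) = (x \in B)) ->
  exists x y, x != y /\ s = tperm x y.
Proof.
move=> leB2 /set0Pn[x Bx] sB; exists x, (s x).
have sx : s x != x by rewrite sB.
have Bsx : s x \in B by rewrite -sB (inj_eq perm_inj).
have DB : B = [set x; s x].
  apply/eqP; rewrite eq_sym eqEcard cards2 eq_sym sx leB2 andbT.
  by apply/subsetP=> y /set2P[]->.
split; first by rewrite eq_sym.
apply/permP=> z; case: tpermP => [->|->|/eqP zx /eqP zy] //.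
  have : s (s x) \in B by rewrite -sB !(inj_eq perm_inj).
  by rewrite DB !inE (inj_eq perm_inj) (negPf sx) orbF => /eqP.
by apply/eqP/negPn; rewrite sB DB !inE negb_or zx zy.
Qed.

Section BringGroup.

Variable alpha : 'I_5 -> algC.
Hypothesis Dalpha : trinomial algC 4 5 = \prod_i ('X - (alpha i)%:P).

Let alpha_inj : injective alpha.
Proof. by apply: bring_roots_inj Dalpha; rewrite pnatr_eq0. Qed.

Let Dalpha_int : map_poly intr (trinomial int 4 5) = \prod_i ('X - (alpha i)%:P).
Proof. by rewrite map_trinomial. Qed.

Lemma bring_frobenius (p : nat) : prime p -> ~~ (p %| 2869)%N ->
  exists (K : fieldType) (a : 'I_5 -> K) s,
    [/\ p \in [pchar K], injective a, forall i, a i ^+ 5 = a i + 1,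
        s \in galois_set alpha & forall i, a (s i) = a i ^+ p].
Proof.
move=> p_pr p_disc.
have [K [a [s [charKp DK Gs as_p]]]] := frobenius_element Dalpha_int alpha_inj p_pr.
rewrite map_trinomial in DK; exists K, a, s; split=> //.
  by apply: bring_roots_inj DK; rewrite -(dvdn_pcharf charKp).
move=> i; apply: bring_root.
by rewrite DK rootE horner_prod (bigD1 i) //= hornerXsubC subrr mul0r.
Qed.

(** Since [x ^+ 5 = x + 1] for each root, the Frobenius map at 5 translates the
    roots by 1. *)
Lemma bring_5cycle : exists2 s, s \in galois_set alpha & #[s]%g = 5%N.
Proof.
have [//|//|K [a [s [charK5 a_inj a5 Gs as5]]]] := @bring_frobenius 5.
exists s => //; apply: (order_of_shift _ _ a_inj) => //; first exact: pcharf0 charK5.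
by move=> i; rewrite as5 a5.
Qed.

(** Modulo 2 the polynomial is (x^2 + x + 1) (x^3 + x^2 + 1), so the Frobenius
    element has a cycle of length 2 and one of length 3; its cube is a
    transposition. The indices of the roots of the quadratic factor form [B]. *)
Lemma bring_transposition :
  exists x y, x != y /\ tperm x y \in galois_set alpha.
Proof.
have [//|//|K [a [s [charK2 a_inj a5 Gs as2]]]] := @bring_frobenius 2.
have two0 : 2 = 0 :> K := pcharf0 charK2.
have as8 i : a ((s ^+ 3)%g i) = a i ^+ 8.
  by rewrite !expgS expg0 mulg1 !permM !as2 -!exprM.
pose B := [set i | a i ^+ 2 + a i + 1 == 0].
have few_roots (q : {poly K}) (D : {set 'I_5}) : q != 0 ->
    (forall i, i \in D -> root q (a i)) -> (#|D| < size q)%N.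
  move=> q0 Dq; rewrite cardE -(size_map a); apply: max_poly_roots => //.
    by apply/allP=> _ /mapP[i + ->]; rewrite mem_enum => /Dq.
  by rewrite map_inj_uniq ?enum_uniq.
(* The roots of the quadratic factor lie in F_4, where x^8 = x^2 = x + 1. *)
have fB i : i \in B -> a i ^+ 8 = a i + 1.
  rewrite inE => /eqP g0.
  have -> : a i ^+ 8 = a i + 1
      + (a i ^+ 2 * (a i ^+ 3 + 1) * (a i - 1) + 1) * (a i ^+ 2 + a i + 1)
      - 2 * (a i + 1) by ring.
  by rewrite g0 two0 mulr0 mul0r addr0 subr0.
have cubic i : i \notin B -> a i ^+ 3 + a i ^+ 2 + 1 = 0.
  rewrite inE => g0; apply: (mulfI g0); rewrite mulr0.
  have -> : (a i ^+ 2 + a i + 1) * (a i ^+ 3 + a i ^+ 2 + 1) =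
      a i ^+ 5 - (a i + 1)
      + 2 * (a i ^+ 4 + a i ^+ 3 + a i ^+ 2 + a i + 1) by ring.
  by rewrite a5 subrr two0 mul0r addr0.
(* The roots of the cubic factor lie in F_8. *)
have fBC i : i \notin B -> a i ^+ 8 = a i.
  move=> /cubic h0.
  have -> : a i ^+ 8 = a i
      + a i * (a i - 1) * (a i ^+ 3 + a i + 1) * (a i ^+ 3 + a i ^+ 2 + 1)
      - 2 * (a i ^+ 4 * (a i - 1)) by ring.
  by rewrite h0 two0 mulr0 mul0r addr0 subr0.
have leB2 : (#|B| <= 2)%N.
  have szq : size ('X^2 + 'X + 1 : {poly K}) = 3.
    by rewrite -addrA size_polyDl size_polyXn // size_XaddC.
  rewrite -ltnS; apply: leq_trans (eq_leq szq); apply: few_roots => [|i].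
    by rewrite -size_poly_gt0 szq.
  by rewrite inE rootE !hornerE.
have B0 : B != set0.
  have szq : size ('X^3 + 'X^2 + 1 : {poly K}) = 4.
    by rewrite -addrA size_polyDl size_polyXn // -polyC1 size_XnaddC.
  apply/eqP => B0; have : (#|[set: 'I_5]| < 4)%N.
    apply: leq_trans (eq_leq szq); apply: few_roots => [|i _].
      by rewrite -size_poly_gt0 szq.
    by rewrite rootE !hornerE; apply/eqP/cubic; rewrite B0 inE.
  by rewrite cardsT card_ord.
have [i|x [y [xy Ds]]] := tperm_of_moved (s := (s ^+ 3)%g) leB2 B0.
  rewrite -(inj_eq a_inj) as8; have [/fB->|/fBC->] := boolP (i \in B); last by rewrite eqxx.
  by rewrite -subr_eq0 addrC addKr oner_neq0.
exists x, y; split=> //; rewrite -Ds.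
exact: (groupX (G := galois_group alpha)).
Qed.

(** In prime degree, a transposition and a cycle of full length generate the
    symmetric group. *)
Lemma bring_galois_group : galois_set alpha = [set: 'S_5].
Proof.
have [c Gc c5] := bring_5cycle; have [x [y [xy Gxy]]] := bring_transposition.
apply/eqP; rewrite eqEsubset subsetT /=.
have genS : <<[set tperm x y; c]>>%g = [set: 'S_5].
  by apply: gen_tperm_circular_shift; rewrite ?card_ord.
rewrite -genS -[galois_set _]/(gval (galois_group alpha)) gen_subG.
by apply/subsetP=> s /set2P[]->.
Qed.

End BringGroup.

Local Notation autC := {rmorphism algC -> algC}.

(** * The derived series of the automorphism group and radicals *)

(** The derived series of the group of automorphisms of [algC]. Products of
    commutators are closed under inverses, because the inverse of a commutator
    is a commutator, so closure under composition is enough. *)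
Inductive derived_aut : nat -> autC -> Prop :=
  | derived_all (nu : autC) : derived_aut 0 nu
  | derived_id k : derived_aut k idfun
  | derived_comp k (nu mu : autC) :
      derived_aut k nu -> derived_aut k mu -> derived_aut k (nu \o mu)
  | derived_comm k (nu mu : autC) : derived_aut k nu -> derived_aut k mu ->
      derived_aut k.+1 (algC_invaut nu \o (algC_invaut mu \o (nu \o mu))).

Definition fixed_at k (x : algC) := forall nu, derived_aut k nu -> nu x = x.

(** If two automorphisms commute at [x], then their commutator fixes [x]. This
    is the only way in which commutators are used on numbers. *)
Lemma fixed_of_commute k x :
    (forall nu mu, derived_aut k nu -> derived_aut k mu -> nu (mu x) = mu (nu x)) ->
  fixed_at k.+1 x.
Proof.
move=> xC nu; move Dm: k.+1 => m der; elim: der Dm => //= {m nu}.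
- by move=> m nu mu _ IHnu _ IHmu Dm; rewrite IHmu // IHnu.
move=> m nu mu der_nu _ der_mu _ [Dm]; rewrite -{m}Dm in der_nu der_mu.
by rewrite xC // !algC_autK.
Qed.

Lemma fixed_at_leq k m x : (k <= m)%N -> fixed_at k x -> fixed_at m x.
Proof.
move=> /subnK <- fix_x; elim: (m - k)%N => // j IHj.
by apply: fixed_of_commute => nu mu der_nu der_mu; rewrite !IHj.
Qed.

(** Automorphisms act on the n-th roots of unity by powers, hence commute. *)
Lemma unity_root_fixed n z k : (0 < n)%N -> z ^+ n = 1 -> fixed_at k.+1 z.
Proof.
by move=> n0 zn1; apply: fixed_of_commute => nu mu _ _; apply: aut_unity_rootC zn1.
Qed.

(** Kummer theory in its simplest form: an automorphism that fixes [y ^+ n]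
    multiplies [y] by a root of unity. Such factors are fixed by the
    automorphisms of positive level, so two of these commute at [y]. *)
Lemma root_fixed n y k : (0 < n)%N -> fixed_at k.+1 (y ^+ n) -> fixed_at k.+2 y.
Proof.
move=> n0 fix_yn; have [-> nu _|y0] := eqVneq y 0; first by rewrite rmorph0.
have twist nu : derived_aut k.+1 nu ->
    exists2 z, nu y = z * y & forall mu, derived_aut k.+1 mu -> mu z = z.
  move=> der; exists (nu y / y); first by rewrite divfK.
  apply: (@unity_root_fixed n) => //.
  by rewrite expr_div_n -rmorphXn fix_yn // divff // expf_neq0.
apply: fixed_of_commute => nu mu der_nu der_mu.
have [[z nuy fix_z] [t muy fix_t]] := (twist _ der_nu, twist _ der_mu).
by rewrite muy nuy !rmorphM muy nuy fix_z // fix_t // mulrCA.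
Qed.

(** Each number expressible by radicals is fixed by some term of the derived
    series: each root extraction costs one more term. The embedding [iota]
    transports this from [algC], which has automorphisms at hand, to [C]; it
    reaches [z] since the n-th roots in [C] of [iota x] are the images of the
    n-th roots of [x]. *)
Lemma radicals_fixed (C : numClosedFieldType) (iota : {rmorphism algC -> C})
    (z : C) :
  by_radicals z -> exists x k, iota x = z /\ fixed_at k.+1 x.
Proof.
elim=> {z} [q|z t _ [x [k [<- fx]]] _ [y [m [<- fy]]]|z _ [x [k [<- fx]]]|
  z t _ [x [k [<- fx]]] _ [y [m [<- fy]]]|z _ [x [k [<- fx]]]|n z n0 _ [x [k [Dx fx]]]].
- by exists (ratr q), 0%N; split=> [|nu _]; rewrite fmorph_rat.
- exists (x + y), (maxn k m); rewrite rmorphD; split=> // nu der; rewrite rmorphD.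
  by rewrite (fixed_at_leq _ fx der) ?(fixed_at_leq _ fy der) // ltnS ?leq_maxl ?leq_maxr.
- by exists (- x), k; rewrite rmorphN; split=> // nu der; rewrite rmorphN fx.
- exists (x * y), (maxn k m); rewrite rmorphM; split=> // nu der; rewrite rmorphM.
  by rewrite (fixed_at_leq _ fx der) ?(fixed_at_leq _ fy der) // ltnS ?leq_maxl ?leq_maxr.
- by exists x^-1, k; rewrite fmorphV; split=> // nu der; rewrite fmorphV fx.
have [r Dr] := closed_field_poly_normal ('X^n - x%:P : {poly algC}).
have : root (map_poly iota ('X^n - x%:P)) z.
  by rewrite rmorphB /= map_polyXn map_polyC rootE !hornerE /= Dx subrr.
rewrite Dr (monicP (monicXnsubC _ n0)) scale1r rmorph_prod.
rewrite (eq_bigr (fun y => 'X - (iota y)%:P)); last first.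
  by move=> y _; rewrite rmorphB /= map_polyX map_polyC.
rewrite -(big_map iota predT (fun w => 'X - w%:P)) root_prod_XsubC => /mapP[y _ Dz].
exists y, k.+1; split=> //; apply: root_fixed n0 _.
have -> // : y ^+ n = x.
by apply: (fmorph_inj iota); rewrite rmorphXn -Dz -Dx.
Qed.

(** The map from automorphisms to permutations is onto by hypothesis, and a
    surjective homomorphism maps each derived subgroup onto the corresponding
    one. *)
Lemma derived_lift n (alpha : 'I_n -> algC) k :
    galois_set alpha = [set: 'S_n] -> forall s : 'S_n, s \in [set: 'S_n]^`(k)%g ->
  exists2 nu, derived_aut k nu & perm_of_aut alpha nu s.
Proof.
move=> full; elim: k => [|k IHk] s.
  by rewrite derg0 -full => /galois_setP[nu]; exists nu => //; apply: derived_all.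
pose H := [set t : 'S_n |
  `[< exists2 nu, derived_aut k.+1 nu & perm_of_aut alpha nu t >]].
have gH : group_set H.
  apply/group_setP; split.
    by rewrite inE; apply/asboolP; exists idfun => [|i]; [apply: derived_id|rewrite perm1].
  move=> t u; rewrite !inE => /asboolP[nu der_nu nut] /asboolP[mu der_mu muu].
  apply/asboolP; exists (mu \o nu); first exact: derived_comp.
  by move=> i; rewrite permM /= nut muu.
rewrite dergSn => Ds; suff: s \in H by rewrite inE => /asboolP.
move: s Ds; apply/subsetP; rewrite -[H]/(gval (Group gH)) gen_subG.
apply/subsetP=> _
  /imset2P[t u /groupVr/IHk[nu der_nu nut] /groupVr/IHk[mu der_mu muu] ->].
rewrite inE; apply/asboolP.
(* Permutations compose from left to right and maps from right to left, so
   that t^-1 u^-1 t u is obtained from lifts of t^-1 and u^-1. *)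
exists (algC_invaut mu \o (algC_invaut nu \o (mu \o nu))); first exact: derived_comm.
have inv_act (lam : autC) v :
    perm_of_aut alpha lam v^-1%g -> perm_of_aut alpha (algC_invaut lam) v.
  by move=> lamv i; apply: (fmorph_inj lam); rewrite algC_invautK lamv permK.
move=> i; rewrite /= nut muu (inv_act _ _ nut) (inv_act _ _ muu).
by rewrite commgEl conjgE !permM.
Qed.

(** If the root were expressible, a term [D] of the derived series of the
    symmetric group would fix the corresponding index. Since [D] is normal and
    the symmetric group is transitive, [D] would fix all indices and be trivial,
    although the symmetric group on five letters is not solvable. *)
Lemma bring_not_by_radicals (C : numClosedFieldType) (z : C) :
  root (trinomial C 4 5) z -> ~ by_radicals z.
Proof.
move=> fz0; have [iota] := embed_algC C => /(radicals_fixed iota)[x [k [Dz fix_x]]].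
have [r Dr] := closed_field_poly_normal (trinomial algC 4 5).
have mon_f : trinomial algC 4 5 \is monic.
  rewrite trinomial_bring monicE -addrA lead_coefDl ?lead_coefXn //.
  by rewrite -opprD size_polyN size_polyXn size_XaddC.
have szf : size (trinomial algC 4 5) = 6.
  by rewrite trinomial_bring -addrA -opprD size_polyDl ?size_polyN size_polyXn ?size_XaddC.
rewrite (monicP mon_f) scale1r in Dr.
have szr : size r = 5 by move: szf; rewrite Dr size_prod_XsubC => -[].
have [alpha Dalpha] : exists alpha : 'I_5 -> algC,
    trinomial algC 4 5 = \prod_i ('X - (alpha i)%:P).
  by exists (fun i => r`_i); rewrite Dr (big_nth 0) szr big_mkord.
have [i Dx] : exists i, x = alpha i.
  apply: root_prod_XsubC_fin; rewrite -Dalpha -(fmorph_root iota) Dz.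
  by rewrite map_trinomial.
have alpha_inj : injective alpha by apply: bring_roots_inj Dalpha; rewrite pnatr_eq0.
have full := bring_galois_group Dalpha.
pose D := ([set: 'S_5]^`(k.+1))%g.
have fix_i s : s \in D -> s i = i.
  move=> /(derived_lift full)[nu der nus]; apply: alpha_inj.
  by rewrite -nus -Dx fix_x.
have nD t : t \in 'N(D)%g.
  by have /subsetP := normal_norm (der_normal k.+1 [set: 'S_5]); apply; rewrite inE.
have D1 : D = 1%g.
  apply/trivgP/subsetP=> s Ds; rewrite inE; apply/eqP/permP => j; rewrite perm1.
  have : ((s ^ tperm i j) (tperm i j j) = tperm i j j)%g.
    by rewrite tpermR fix_i // memJ_norm.
  by rewrite permJ => /perm_inj.
have := @solvable_SymF 'I_5; rewrite card_ord => /(_ isT)/negP; apply.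
by apply/derivedP; exists k.+1.
Qed.

(** * The positive root of the trinomial *)

(** In this form the equation shows at once that a positive root is greater
    than 1, and that there is only one: beyond 1 the left-hand side is
    increasing. *)
Lemma root_trinomial (R : comNzRingType) (l r : nat) (x : R) : (l <= r)%N ->
  root (trinomial R l r) x = (x ^+ (r - l) * (x ^+ l - 1) == 1).
Proof.
move=> lr; rewrite rootE /trinomial !hornerE mulrBr mulr1 -exprD subnK //.
by rewrite subr_eq0.
Qed.

Lemma trinomial_positive_root (R : rcfType) (l r : nat) : (1 <= l <= r)%N ->
  exists x : R, [/\ 1 < x, root (trinomial R l r) x
    & forall y, 0 < y -> root (trinomial R l r) y -> x = y].
Proof.
case/andP=> l0 lr.
have gt1 (y : R) : 0 < y -> root (trinomial R l r) y -> 1 < y.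
  move=> y0; rewrite root_trinomial // ltNge; apply: contraTN => y1.
  rewrite lt_eqF // (le_lt_trans _ ltr01) // mulr_ge0_le0 ?exprn_ge0 ?(ltW y0) //.
  by rewrite subr_le0 exprn_ile1 // ltW.
have uniq (x y : R) : 1 < x -> x < y -> root (trinomial R l r) x ->
    ~~ root (trinomial R l r) y.
  move=> x1 xy; rewrite !root_trinomial // => /eqP Dx; rewrite gt_eqF // -[ltLHS]Dx.
  have x0 := lt_trans ltr01 x1; have y0 := lt_trans x0 xy.
  apply: (@le_lt_trans _ _ (y ^+ (r - l) * (x ^+ l - 1))).
    by rewrite ler_wpM2r ?subr_ge0 ?exprn_ege1 ?lerXn2r ?nnegrE // ltW.
  by rewrite ltr_pM2l ?exprn_gt0 // ltrD2r ltrXn2r ?ltW // -lt0n.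
have [|x /andP[x_ge1 _] xroot] := @poly_ivt R (trinomial R l r) 1 2 (ler1n _ 2).
  rewrite /trinomial !hornerE !expr1n subrr sub0r lerN10 /=.
  rewrite -(subnK lr) exprD addnK -[X in _ - X - _]mulr1 -mulrBr subr_ge0.
  rewrite mulr_ege1 ?exprn_ege1 ?ler1n // lerBrDr.
  by rewrite -[leLHS]/(2%:R : R) ler_eXnr ?ler1n.
have x1 : 1 < x by apply: gt1 => //; apply: lt_le_trans x_ge1.
exists x; split=> // y y0 yroot; apply/eqP; case: ltgtP => // [xy|yx].
  by move: (uniq _ _ x1 xy xroot); rewrite yroot.
by move: (uniq _ _ (gt1 _ y0 yroot) yx yroot); rewrite xroot.
Qed.

Theorem theorem1 (R : realType) :
  (forall l r : nat, (1 <= l <= r)%N ->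
     exists x : R, unique (positive_root (trinomial R l r)) x /\
                   unique (root_gt1 (trinomial R l r)) x) /\
  ~ (forall l r : nat, (1 <= l <= r)%N ->
       forall x : R, unique (positive_root (trinomial R l r)) x ->
         by_radicals (real_complex R x : R[i])).
Proof.
have unique_root l r : (1 <= l <= r)%N -> exists x : R,
    unique (positive_root (trinomial R l r)) x /\
    unique (root_gt1 (trinomial R l r)) x.
  move=> /(trinomial_positive_root R)[x [x1 rx x_uniq]]; exists x.
  split; split=> //.
  - by split=> //; apply: lt_trans ltr01 x1.
  - by move=> y [y0 ry]; apply: x_uniq.
  - by move=> y [y1 ry]; apply: x_uniq => //; apply: lt_trans ltr01 y1.
split=> // radicals; have [x [xroot _]] := unique_root 4 5 isT.
apply: bring_not_by_radicals (radicals 4 5 isT x xroot).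
by rewrite -(map_trinomial (real_complex R)) fmorph_root; case: xroot => -[].
Qed.
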